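(* Let $\mathcal L$ be the language consisting of unary predicates $P_i$ for $i\in\omega_1$. For finite $I,J\subseteq\omega_1$ with $I\cap J=\emptyset$ and $n\in\mathbb N$ let $\sigma_{I,J,n}$ be the sentence $\exists^{\ge n}x\,\bigl(\bigwedge_{i\in I}P_i(x)\wedge\bigwedge_{j\in J}\neg P_j(x)\bigr)$, and let $T$ be the theory consisting of all the sentences $\sigma_{I,J,n}$. Then $T$ is complete, has quantifier elimination, is dp-minimal (in fact has VC-density one), but is not VC-minimal.
   Context: An ICT pattern in a structure $M$ consists of formulae $\phi(x,\bar y)$, $\psi(x,\bar y)$, with $x$ a single variable and $\bar y$ a finite tuple of variables, and sequences $(\bar a_i)_{i\in\omega}$, $(\bar b_i)_{i\in\omega}$ of tuples from $M$ such that for all $i,j\in\omega$ the set $\{\phi(x,\bar a_i),\psi(x,\bar b_j)\}\cup\{\neg\phi(x,\bar a_l):l\neq i\}\cup\{\neg\psi(x,\bar b_k):k\neq j\}$ is consistent (realized in some elementary extension of $M$). A theory is dp-minimal if there is no ICT pattern in any of its models. For a finite set of formulae $\Delta(\bar x,\bar y)$ ($\bar y$ the parameter variables) and a set $A$ of $|\bar y|$-tuples, $S^\Delta(A)$ is the set of complete $\Delta$-types with parameters from $A$. $T$ has VC-density one if for any finite $\Delta(\bar x,\bar y)$ there is a constant $C$ so that for any finite nonempty set $A$ of $|\bar y|$-tuples, $|S^\Delta(A)|\le C|A|^{|\bar x|}$. Let $\mathfrak C$ be a monster model of $T$ with universe $C$. $T$ is VC-minimal if there is a family $\Phi$ of formulae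 of the form $\phi(x,\bar y)$ ($x$ a single variable) such that: (i) if $\phi(x,\bar y),\psi(x,\bar y)\in\Phi$ and $\bar a,\bar b$ are tuples from $C$ then one of $\phi(C,\bar a)\subseteq\psi(C,\bar b)$, $\psi(C,\bar b)\subseteq\phi(C,\bar a)$, $\neg\phi(C,\bar a)\subseteq\psi(C,\bar b)$, $\psi(C,\bar b)\subseteq\neg\phi(C,\bar a)$ holds; and (ii) for every definable (with parameters) $X\subseteq C$ there are finitely many $\phi_i(x,\bar y)\in\Phi$ and tuples $\bar a_i$ from $C$ such that $X$ is a Boolean combination of the sets $\phi_i(C,\bar a_i)$. *)

(* Defs.v *)
From mathcomp Require Import all_boot all_order.
From mathcomp Require Import finmap.
From mathcomp Require Import boolp classical_sets functions cardinality.

Set Implicit Arguments.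
Unset Strict Implicit.
Unset Printing Implicit Defensive.

Local Open Scope classical_set_scope.
Local Open Scope card_scope.

(** * First-order logic *)

Record language := Language {
  fun_sym : Type;
  fun_ar : fun_sym -> nat;
  rel_sym : Type;
  rel_ar : rel_sym -> nat }.

(* The free variables of a [term L n] or [formula L n] are indexed by ['I_n].
   In [FEx phi], with [phi : formula L n.+1], the bound variable is
   [ord0 : 'I_n.+1] and the free variable [i : 'I_n] of [FEx phi] is the
   variable [rshift 1 i] of [phi]. *)
Inductive term (L : language) (n : nat) : Type :=
| TVar of 'I_n
| TApp (f : fun_sym L) of ('I_(fun_ar f) -> term L n).

Inductive formula (L : language) : nat -> Type :=
| FBot n : formula L n
| FEq n : term L n -> term L n -> formula L n
| FRel n (r : rel_sym L) : ('I_(rel_ar r) -> term L n) -> formula L n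
| FNot n : formula L n -> formula L n
| FAnd n : formula L n -> formula L n -> formula L n
| FEx n : formula L n.+1 -> formula L n.

Arguments TVar {L n}.
Arguments TApp {L n}.
Arguments FBot {L n}.
Arguments FEq {L n}.
Arguments FRel {L n}.
Arguments FNot {L n}.
Arguments FAnd {L n}.
Arguments FEx {L n}.

Definition FTop {L n} : formula L n := FNot FBot.

Fixpoint qfree L n (phi : formula L n) : Prop :=
  match phi with
  | FBot _ | FEq _ _ _ | FRel _ _ _ => True
  | FNot _ p => qfree p
  | FAnd _ p q => qfree p /\ qfree q
  | FEx _ _ => False
  end.

Record structure (L : language) := Structure {
  carrier :> Type;
  carrier_inhabited : inhabited carrier;
  fun_interp : forall f : fun_sym L, ('I_(fun_ar f) -> carrier) -> carrier;
  rel_interp : forall r : rel_sym L, ('I_(rel_ar r) -> carrier) -> Prop }.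

Arguments fun_interp {L} s f _.
Arguments rel_interp {L} s r _.

(* Concatenation of the tuples x and y. *)
Definition join (X : Type) n m (x : 'I_n -> X) (y : 'I_m -> X) : 'I_(n + m) -> X :=
  fun k => match fintype.split k with inl i => x i | inr j => y j end.

Definition tup1 (X : Type) (c : X) : 'I_1 -> X := fun=> c.

Fixpoint teval L (M : structure L) n (v : 'I_n -> M) (t : term L n) : M :=
  match t with
  | TVar i => v i
  | TApp f ts => fun_interp M f (fun i => teval v (ts i))
  end.

Fixpoint sat L (M : structure L) n (phi : formula L n) : ('I_n -> M) -> Prop :=
  match phi in formula _ n return ('I_n -> M) -> Prop with
  | FBot _ => fun=> False
  | FEq _ t u => fun v => teval v t = teval v u
  | FRel _ r ts => fun v => rel_interp M r (fun i => teval v (ts i))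
  | FNot _ p => fun v => ~ sat p v
  | FAnd _ p q => fun v => sat p v /\ sat q v
  | FEx _ p => fun v => exists c : M, sat p (join (tup1 c) v)
  end.

Arguments sat {L} M {n} phi v.

Definition sentence L := formula L 0.
Definition theory L := set (sentence L).

Definition true_in L (M : structure L) (s : sentence L) : Prop :=
  forall v : 'I_0 -> M, sat M s v.

Definition is_model L (T : theory L) (M : structure L) : Prop :=
  forall s, T s -> true_in M s.

Definition entails L (T : theory L) (s : sentence L) : Prop :=
  forall M : structure L, is_model T M -> true_in M s.

Definition complete_theory L (T : theory L) : Prop :=
  (exists M : structure L, is_model T M) /\
  forall s : sentence L, entails T s \/ entails T (FNot s).

Definition has_QE L (T : theory L) : Prop :=
  forall n (phi : formula L n), exists psi : formula L n,
    qfree psi /\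
    forall M : structure L, is_model T M ->
      forall v : 'I_n -> M, sat M phi v <-> sat M psi v.

Definition elementary_embedding L (M N : structure L) (h : M -> N) : Prop :=
  forall n (phi : formula L n) (v : 'I_n -> M), sat M phi v <-> sat N phi (h \o v).

(** * Types *)

(* A formula phi(x, a) in the n variables x with parameters a from M. *)
Record instance L (M : structure L) (n : nat) := Inst {
  inst_ar : nat;
  inst_form : formula L (n + inst_ar);
  inst_par : 'I_inst_ar -> M }.

Arguments Inst {L M n inst_ar} inst_form inst_par.
Arguments inst_par {L M n} i _.

Definition consistent L (M : structure L) n (p : set (instance M n)) : Prop :=
  exists (N : structure L) (h : M -> N),
    elementary_embedding h /\
    exists x : 'I_n -> N,
      forall q, p q -> sat N (inst_form q) (join x (h \o inst_par q)).

Definition card_lt (X Y : Type) (A : set X) (B : set Y) : Prop := ~ (B #<= A).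

(** * dp-minimality *)

Definition ICT_pattern L (M : structure L) m (phi psi : formula L (1 + m))
    (a b : nat -> 'I_m -> M) : Prop :=
  forall i j : nat,
    consistent ([set Inst phi (a i); Inst psi (b j)]
                `|` [set Inst (FNot phi) (a l) | l in [set l | l <> i]]
                `|` [set Inst (FNot psi) (b k) | k in [set k | k <> j]]).

Definition dp_minimal L (T : theory L) : Prop :=
  forall M : structure L, is_model T M ->
    ~ exists m (phi psi : formula L (1 + m)) (a b : nat -> 'I_m -> M),
        ICT_pattern phi psi a b.

(** * VC-density one *)

Definition complete_Delta_type L (M : structure L) n m
    (Delta : set (formula L (n + m))) (A : set ('I_m -> M))
    (p : set (instance M n)) : Prop :=
  [/\ consistent p,
      p `<=` [set q | exists2 phi, Delta phi & exists2 a, A a &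
                        q = Inst phi a \/ q = Inst (FNot phi) a]
    & forall phi a, Delta phi -> A a -> p (Inst phi a) \/ p (Inst (FNot phi) a)].

(* |A| = k is expressed as [A #= `I_k], where [`I_k] is {0, ..., k-1}. *)
Definition VC_density_one L (T : theory L) : Prop :=
  forall n m (Delta : set (formula L (n + m))), finite_set Delta ->
    exists C : nat, forall M : structure L, is_model T M ->
      forall (A : set ('I_m -> M)) (k : nat), A !=set0 -> A #= `I_k ->
        [set p | complete_Delta_type Delta A p] #<= `I_(C * k ^ n).

(** * Monster models and VC-minimality *)

(* The cardinal kappa is represented by a type K with |K| = kappa. *)
Definition saturated L (K : Type) (M : structure L) : Prop :=
  forall A : set M, card_lt A [set: K] ->
    forall p : set (instance M 1),
      (forall q, p q -> forall i, A (inst_par q i)) ->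
      consistent p ->
      exists x : 'I_1 -> M, forall q, p q -> sat M (inst_form q) (join x (inst_par q)).

Definition automorphism L (M : structure L) (g : M -> M) : Prop :=
  [/\ bijective g,
      forall f v, g (fun_interp M f v) = fun_interp M f (g \o v)
    & forall r v, rel_interp M r v <-> rel_interp M r (g \o v)].

Definition strongly_homogeneous L (K : Type) (M : structure L) : Prop :=
  forall (A : set M) (f : M -> M), card_lt A [set: K] ->
    (forall n (phi : formula L n) (v : 'I_n -> M), (forall i, A (v i)) ->
       sat M phi v <-> sat M phi (f \o v)) ->
    exists g : M -> M, automorphism g /\ forall c, A c -> g c = f c.

(* kappa-saturated and strongly kappa-homogeneous for some kappa > |L|, where
   |L| is the number of L-formulas. *)
Definition monster_model L (T : theory L) (M : structure L) : Prop :=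
  is_model T M /\
  exists K : Type,
    [/\ card_lt [set: {n : nat & formula L n}] [set: K],
        saturated K M & strongly_homogeneous K M].

Definition inst_set L (M : structure L) m (phi : formula L (1 + m)) (a : 'I_m -> M)
  : set M := [set c | sat M phi (join (tup1 c) a)].

Definition definable L (M : structure L) (X : set M) : Prop :=
  exists m (phi : formula L (1 + m)) (a : 'I_m -> M), X = inst_set phi a.

Inductive boolean_combination (X : Type) (G : set (set X)) : set X -> Prop :=
| bc_gen A : G A -> boolean_combination G A
| bc_empty : boolean_combination G set0
| bc_compl A : boolean_combination G A -> boolean_combination G (~` A)
| bc_union A B : boolean_combination G A -> boolean_combination G B ->
    boolean_combination G (A `|` B).

Definition generating_family L (M : structure L)
    (Phi : forall m, set (formula L (1 + m))) : Prop :=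
  (forall m k (phi : formula L (1 + m)) (psi : formula L (1 + k)),
     Phi m phi -> Phi k psi ->
     forall (a : 'I_m -> M) (b : 'I_k -> M),
       [\/ inst_set phi a `<=` inst_set psi b,
           inst_set psi b `<=` inst_set phi a,
           ~` inst_set phi a `<=` inst_set psi b
         | inst_set psi b `<=` ~` inst_set phi a]) /\
  (forall X : set M, definable X ->
     boolean_combination
       [set Y | exists m (phi : formula L (1 + m)) (a : 'I_m -> M),
                  Phi m phi /\ Y = inst_set phi a] X).

Definition VC_minimal L (T : theory L) : Prop :=
  exists M : structure L, monster_model T M /\
    exists Phi : forall m, set (formula L (1 + m)), generating_family M Phi.

(** * The theory T *)

(* A linear order has order type omega_1 iff it is an uncountable well-order
   all of whose proper initial segments are countable. *)
Definition is_omega1 (d : Order.disp_t) (W : orderType d) : Prop :=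
  [/\ well_founded (fun x y : W => (x < y)%O),
      ~ countable [set: W]
    & forall x : W, countable [set y : W | (y < x)%O]].

Definition unary_language (W : Type) : language :=
  {| fun_sym := void; fun_ar := fun=> 0; rel_sym := W; rel_ar := fun=> 1 |}.

Definition P (W : Type) (i : W) n (t : term (unary_language W) n)
  : formula (unary_language W) n :=
  @FRel (unary_language W) n i (fun=> t).

Fixpoint exists_closure L n : formula L n -> sentence L :=
  match n with
  | 0 => fun phi => phi
  | n'.+1 => fun phi => exists_closure (FEx phi)
  end.

(* "There are at least n elements x satisfying theta", for theta given as a
   function of the variable. *)
Definition exists_at_least L n (theta : term L n -> formula L n) : sentence L :=
  exists_closure
    (FAnd (\big[FAnd/FTop]_(i < n) \big[FAnd/FTop]_(j < n | i < j)
             FNot (FEq (TVar i) (TVar j)))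
          (\big[FAnd/FTop]_(i < n) theta (TVar i))).

Definition sigma (W : choiceType) (I J : {fset W}) (n : nat)
  : sentence (unary_language W) :=
  @exists_at_least (unary_language W) n (fun t =>
    FAnd (\big[FAnd/FTop]_(i <- I) P i t)
         (\big[FAnd/FTop]_(j <- J) FNot (P j t))).

Definition T_omega1 (W : choiceType) : theory (unary_language W) :=
  [set s | exists (I J : {fset W}) (n : nat),
             [disjoint I & J]%fset /\ s = sigma I J n].

Arguments T_omega1 W _ : clear implicits.

(* Main.v *)
Require Import Defs.
From mathcomp Require Import all_boot all_order.
From mathcomp Require Import finmap.
From mathcomp Require Import boolp classical_sets functions cardinality.

Set Implicit Arguments.
Unset Strict Implicit.
Unset Printing Implicit Defensive.

Local Open Scope classical_set_scope.
Local Open Scope card_scope.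

(** In a model of T every consistent prescription of finitely many of the P_i
    is met by infinitely many elements.  So two tuples, possibly in different
    models, with the same equalities among their coordinates and the same
    values of P_i for i in a finite set S are matched by a back-and-forth, and
    satisfy the same formulas whose predicates are in S ([sat_similar]).
    Everything positive follows.  Completeness is the case of empty tuples.
    For quantifier elimination, only finitely many such diagrams exist for a
    given S and n, each is described by a quantifier-free formula, and a
    formula is equivalent to the disjunction of the diagrams compatible with
    it.

    For VC-density, the Delta-type of an n-tuple over k parameter tuples of
    length m is determined by which of its coordinates equal which of the at
    most k * m parameters, together with its diagram over the predicates of
    Delta.  This leaves (k * m + 1) ^ n * D possibilities, where D counts
    diagrams, and for k > 0 this is at most ((m + 1) ^ n * D) * k ^ n.
    Dp-minimality then holds for a counting reason valid in every theory: an
    ICT pattern yields N ^ 2 types in one variable over at most 2 * N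
    parameters ([VC_density_one_dp_minimal]).

    Against VC-minimality: an instance phi(x, a) depends, outside the finite
    set a, only on the finitely many predicates of phi.  Hence for each
    pattern Q of truth values of the P_i the sets containing almost every
    element of pattern Q behave on such sets as an ultrafilter ([generic]).
    Since P_i itself is a Boolean combination of instances from a generating
    family, some instance B_i of the family distinguishes the pattern where
    all predicates fail from the one where only P_i holds.  There are
    uncountably many i and each B_i depends on finitely many predicates, so
    there are i, j such that B_i does not depend on P_j nor B_j on P_i
    ([free_pair]).  Then flipping P_i and flipping P_j change membership in
    B_i and in B_j independently: all four Boolean cells of B_i and B_j are
    nonempty, which the nesting condition forbids. *)

(** * Tuples, cardinals and formulas *)

Lemma join_lshift (X : Type) n m (x : 'I_n -> X) (y : 'I_m -> X) i :
  join x y (lshift m i) = x i.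
Proof. by rewrite /join -[lshift m i]/(unsplit (inl i)) unsplitK. Qed.

Lemma join_rshift (X : Type) n m (x : 'I_n -> X) (y : 'I_m -> X) j :
  join x y (rshift n j) = y j.
Proof. by rewrite /join -[rshift n j]/(unsplit (inr j)) unsplitK. Qed.

Lemma join_split (X : Type) n m (z : 'I_(n + m) -> X) :
  join (z \o lshift m) (z \o @rshift n m) = z.
Proof.
apply: funext => k; case: (split_ordP k) => j ->.
  by rewrite join_lshift.
by rewrite join_rshift.
Qed.

Definition tuple0 (X : Type) (i : 'I_0) : X := False_rect X (notF (ltn_ord i)).

Lemma tuple0_eq (X : Type) (v w : 'I_0 -> X) : v = w.
Proof. by apply: funext => -[]. Qed.

Lemma card_setT_fin (F : finType) : [set: F] #= `I_#|F|.
Proof.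
have rank_inj : injective (fun x : F => enum_rank x : nat).
  by move=> x y /ord_inj/enum_rank_inj.
apply: Cantor_Bernstein.
  rewrite -[[set: F]](_ : (fun x : F => enum_rank x : nat) @^-1` `I_#|F| = _).
    by apply: card_ge_preimage => x y _ _; apply: rank_inj.
  by apply/seteqP; split=> // x _ /=.
apply: card_le_trans (card_image_le (fun x : F => enum_rank x : nat) _).
apply: subset_card_le => i /= iF.
by exists (enum_val (Ordinal iF)); rewrite ?enum_valK.
Qed.

Section Formulas.
Variables (L : language) (M : structure L).

Lemma sat_bigFAnd n (I : eqType) (r : seq I) (Q : pred I)
    (F : I -> formula L n) (v : 'I_n -> M) :
  sat M (\big[FAnd/FTop]_(i <- r | Q i) F i) v <->
  (forall i, i \in r -> Q i -> sat M (F i) v).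
Proof.
elim: r => [|i r IH]; first by rewrite big_nil; split=> // _ [].
rewrite big_cons; case: ifP => Qi /=; rewrite IH; split.
- by move=> [Fi Fr] j; rewrite in_cons => /orP[/eqP -> //|]; apply: Fr.
- move=> H; split; first by apply: H; rewrite ?mem_head.
  by move=> j jr; apply: H; rewrite in_cons jr orbT.
- move=> Fr j; rewrite in_cons => /orP[/eqP ->|]; last exact: Fr.
  by rewrite Qi.
- by move=> H j jr; apply: H; rewrite in_cons jr orbT.
Qed.

Lemma sat_bigFAnd_fin n (I : finType) (Q : pred I)
    (F : I -> formula L n) (v : 'I_n -> M) :
  sat M (\big[FAnd/FTop]_(i | Q i) F i) v <->
  (forall i, Q i -> sat M (F i) v).
Proof.
rewrite sat_bigFAnd; split=> H i; last by move=> _; apply: H.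
by apply: H; rewrite mem_index_enum.
Qed.

Lemma qfree_bigFAnd n (I : Type) (r : seq I) (Q : pred I)
    (F : I -> formula L n) :
  (forall i, qfree (F i)) -> qfree (\big[FAnd/FTop]_(i <- r | Q i) F i).
Proof. by move=> qF; elim/big_ind: _ => // p q. Qed.

(** Although the closure quantifies one variable at a time, its semantics is a
    single choice of a tuple; this is how the sentences of T are read. *)
Lemma sat_exists_closure n (phi : formula L n) (v0 : 'I_0 -> M) :
  sat M (exists_closure phi) v0 <-> exists v : 'I_n -> M, sat M phi v.
Proof.
elim: n phi => [|n IH] phi /=.
  by split=> [|[v]]; [exists v0|rewrite (tuple0_eq v v0)].
rewrite IH; split=> [[v [c satc]]|[v satv]].
  by exists (join (tup1 c) v).
exists (v \o @rshift 1 n), (v ord0).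
suff -> : tup1 (v ord0) = v \o @lshift 1 n by rewrite join_split.
by apply: funext => i /=; rewrite ord1 /tup1; congr v; apply: val_inj.
Qed.

End Formulas.

(** * Realized Delta-types and dp-minimality *)

Section DeltaTypes.
Variable L : language.
Implicit Types M N : structure L.

Definition realized_type M N (h : M -> N) n m (Delta : set (formula L (n + m)))
    (A : set ('I_m -> M)) (x : 'I_n -> N) : set (instance M n) :=
  [set q | (exists2 phi, Delta phi & exists2 a, A a &
              q = Inst phi a \/ q = Inst (FNot phi) a) /\
           sat N (inst_form q) (join x (h \o inst_par q))].

Lemma realized_type_complete M N (h : M -> N) n m
    (Delta : set (formula L (n + m))) (A : set ('I_m -> M)) (x : 'I_n -> N) :
  elementary_embedding h -> complete_Delta_type Delta A (realized_type h Delta A x).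
Proof.
move=> elh; split=> [|q []//|phi a Dphi Aa].
  by exists N, h; split=> //; exists x => q [].
have [sx|nsx] := pselect (sat N phi (join x (h \o a))); [left|right].
  by split=> //; exists phi => //; exists a => //; left.
by split=> //; exists phi => //; exists a => //; right.
Qed.

(** A complete type is recovered from any realization: completeness puts one of
    each formula and its negation in the type, and the realization says which.
    Counting types thereby becomes counting realizations. *)
Lemma complete_type_realized M n m (Delta : set (formula L (n + m)))
    (A : set ('I_m -> M)) (p : set (instance M n)) :
  complete_Delta_type Delta A p ->
  exists N (h : M -> N), elementary_embedding h /\
    exists x, p = realized_type h Delta A x.
Proof.
move=> [[N [h [elh [x px]]]] psub pdec]; exists N, h; split=> //; exists x.
apply/seteqP; split=> q; first by move=> pq; split; [exact: psub|exact: (px q pq)].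
move=> [[phi Dphi [a Aa]]] [->|->] /= sx; have [pa|pna] := pdec phi a Dphi Aa => //.
  by have /= := px _ pna.
by have := px _ pa.
Qed.

(** The element realizing the (i, j) condition of an ICT pattern has a type that
    remembers both i and j, so restricting the pattern to i, j < N gives N ^ 2
    types over the 2 * N parameters a_i and b_j. *)
Lemma VC_density_one_dp_minimal (T : theory L) : VC_density_one T -> dp_minimal T.
Proof.
move=> vcT M modM [m [phi [psi [a [b ict]]]]].
pose Delta : set (formula L (1 + m)) := [set phi; psi].
have [|C boundC] := vcT 1 m Delta; first exact: finite_set2.
(* The least size for which n ^ 2 exceeds the bound C * (2 * n). *)
pose n := (2 * C).+1.
pose A := range (fun t : 'I_n + 'I_n => match t with inl i => a i | inr j => b j end).
have A0 : A !=set0 by exists (a 0), (inl ord0).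
have finA : finite_set A by apply/finite_image/finite_finset.
have [k Ak] := (finite_setP A).1 finA.
have kn : k <= 2 * n.
  rewrite -card_le_II -(card_le_eql Ak).
  apply: card_le_trans (card_image_le _ _) _.
  by rewrite (card_le_eql (card_setT_fin _)) card_sum !card_ord mul2n addnn card_lexx.
have aA (i : 'I_n) : A (a i) by exists (inl i).
have bA (j : 'I_n) : A (b j) by exists (inr j).
(* Only the positive instances of phi and psi are recorded about p t: they
   already determine t. *)
have /choice[p pP] (t : 'I_n * 'I_n) : exists p : set (instance M 1),
    [/\ complete_Delta_type Delta A p,
       forall i : 'I_n, p (Inst phi (a i)) <-> i = t.1 &
       forall j : 'I_n, p (Inst psi (b j)) <-> j = t.2].
  have [N [h [elh [x px]]]] := ict t.1 t.2.
  exists (realized_type h Delta A x); split=> [|i|j].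
  - exact: realized_type_complete.
  - split=> [[_ /= sx]|->].
      apply: contrapT => it; have := px (Inst (FNot phi) (a i)).
      by apply=> //; left; right; exists i => // /ord_inj.
    split; last by apply: (px (Inst phi (a t.1))); left; left; left.
    by exists phi; [left|exists (a t.1) => //; left].
  - split=> [[_ /= sx]|->].
      apply: contrapT => jt; have := px (Inst (FNot psi) (b j)).
      by apply=> //; right; exists j => // /ord_inj.
    split; last by apply: (px (Inst psi (b t.2))); left; left; right.
    by exists psi; [right|exists (b t.2) => //; left].
have p_inj : injective p.
  move=> [i j] [i' j'] epp; have [_ pa pb] := pP (i, j).
  have [_ pa' pb'] := pP (i', j').
  by congr pair; [apply/pa'; rewrite -epp; apply/pa|apply/pb'; rewrite -epp; apply/pb].
have : `I_(n * n) #<= `I_(C * k ^ 1).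
  apply: card_le_trans (boundC M modM A k A0 Ak).
  have := card_setT_fin ('I_n * 'I_n)%type; rewrite card_prod !card_ord => cn.
  rewrite -(card_le_eql cn).
  rewrite -[X in X #<= _](_ : p @^-1` [set q | complete_Delta_type Delta A q] = _).
    by apply: card_ge_preimage => t u _ _; apply: p_inj.
  by apply/seteqP; split=> // t _; have [] := pP t.
rewrite card_le_II expn1 leqNgt => /negP; apply.
apply: leq_ltn_trans (leq_mul (leqnn C) kn) _.
by rewrite mulnA ltn_pmul2r // mulnC.
Qed.

End DeltaTypes.

(** * Back-and-forth between rich structures *)

Section UnaryPredicates.
Variable W : choiceType.
Local Notation L := (unary_language W).
Implicit Types (M N : structure L) (S : seq W).

Definition holds M (s : W) (c : M) : Prop := @rel_interp L M s (fun=> c).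

(** A sequence rather than a set, as finiteness of the predicates involved is
    used throughout. *)
Fixpoint symbols n (phi : formula L n) : seq W :=
  match phi with
  | FBot _ | FEq _ _ _ => [::]
  | FRel _ r _ => [:: r : W]
  | FNot _ p => symbols p
  | FAnd _ p q => symbols p ++ symbols q
  | FEx _ p => symbols p
  end.

Lemma term_var n (t : term L n) : exists i, t = TVar i.
Proof. by case: t => [i|[]]; exists i. Qed.

(** Equality of quantifier-free types over the predicates in S, across two
    structures. *)
Definition similar S M N n (v : 'I_n -> M) (w : 'I_n -> N) : Prop :=
  (forall i j, v i = v j <-> w i = w j) /\
  (forall s i, s \in S -> holds s (v i) <-> holds s (w i)).

Lemma similar_sym S M N n (v : 'I_n -> M) (w : 'I_n -> N) :
  similar S v w -> similar S w v.
Proof.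
by move=> [eqvw Pvw]; split=> [i j|s i sS]; apply: iff_sym;
  [apply: eqvw|apply: Pvw].
Qed.

Lemma similar_join S M N n m (x : 'I_n -> M) (y : 'I_m -> M)
    (x' : 'I_n -> N) (y' : 'I_m -> N) :
  similar S x x' -> similar S y y' ->
  (forall i j, x i = y j <-> x' i = y' j) ->
  similar S (join x y) (join x' y').
Proof.
move=> [eqx Px] [eqy Py] eqxy; split=> [k l|s k sS].
  case: (split_ordP k) => i ->; case: (split_ordP l) => j ->;
    rewrite ?join_lshift ?join_rshift //.
  by split=> /esym /eqxy.
by case: (split_ordP k) => i ->; rewrite ?join_lshift ?join_rshift;
  [apply: Px|apply: Py].
Qed.

(** The only property of models of T that is used: elements of any finite
    pattern exist outside any finite set.  Avoiding a set E is more convenient than counting,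
    and by iteration it amounts to having infinitely many such elements. *)
Definition rich M : Prop :=
  forall S (E : set M) (Q : W -> Prop), finite_set E ->
    exists2 c, ~ E c & forall s, s \in S -> holds s c <-> Q s.

(** The forth step.  A new element c that repeats a coordinate of v is answered
    by the same coordinate of w; otherwise richness gives an element of the
    same pattern as c outside w. *)
Lemma similar_extend S M N n (v : 'I_n -> M) (w : 'I_n -> N) :
  rich N -> similar S v w ->
  forall c : M, exists d : N, similar S (join (tup1 c) v) (join (tup1 d) w).
Proof.
move=> richN simvw c; have [eqvw Pvw] := simvw.
have [[i vi]|cNv] := pselect (exists i, v i = c).
  exists (w i); apply: similar_join => //; rewrite /tup1 -vi.
    by split=> // s k; apply: Pvw.
  by move=> _ j; apply: eqvw.
have [|d dNw Pd] := richN S (range w) (fun s => holds s c).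
  exact/finite_image/finite_finset.
exists d; apply: similar_join => //.
  by split=> // s k /Pd; rewrite /tup1 => Pdc; apply: iff_sym.
move=> k0 j; rewrite /tup1; split=> [cv|dw]; first by case: cNv; exists j.
by case: dNw; exists j.
Qed.

(** Richness and similarity are symmetric in M and N, so the forth step also
    serves as the back step at a quantifier. *)
Lemma sat_similar n (phi : formula L n) S M N (v : 'I_n -> M) (w : 'I_n -> N) :
  {subset symbols phi <= S} -> rich M -> rich N -> similar S v w ->
  sat M phi v <-> sat N phi w.
Proof.
move=> + richM richN.
elim: phi v w => {n} [n|n t u|n r ts|n p IH|n p IHp q IHq|n p IH] v w /= subS simvw.
- by [].
- have [i ->] := term_var t; have [j ->] := term_var u.
  by case: simvw => eqvw _; apply: eqvw.
- have [i ei] := term_var (ts ord0).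
  have evl (K : structure L) (z : 'I_n -> K) :
      (fun k => teval z (ts k)) = fun=> z i.
    by apply: funext => k; rewrite (ord1 k) ei.
  rewrite !evl; case: simvw => _ Pvw; apply: Pvw; apply: subS.
  by rewrite mem_head.
- by rewrite (IH v w).
- rewrite (IHp v w) ?(IHq v w) // => s sp; apply: subS; rewrite mem_cat sp //.
  by rewrite orbT.
- split=> -[c satc].
    have [d simd] := similar_extend richN simvw c.
    by exists d; apply/(IH _ _ subS simd).
  have [d simd] := similar_extend richM (similar_sym simvw) c.
  by exists d; apply/(IH _ _ subS (similar_sym simd)).
Qed.

(** * Diagrams *)

(** Only the predicates in S are recorded, so that the type of diagrams is
    finite. *)
Definition diagram_type S n : finType :=
  ({ffun 'I_n * 'I_n -> bool} * {ffun 'I_n * seq_sub S -> bool})%type.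

Definition diagram S M n (v : 'I_n -> M) : diagram_type S n :=
  ([ffun p => `[< v p.1 = v p.2 >]],
   [ffun p => `[< holds (ssval p.2) (v p.1) >]]).

Lemma diagramP S M N n (v : 'I_n -> M) (w : 'I_n -> N) :
  diagram S v = diagram S w <-> similar S v w.
Proof.
split=> [[/ffunP eqvw /ffunP Pvw]|[eqvw Pvw]].
  split=> [i j|s i sS].
    by apply: asbool_eq_equiv; have := eqvw (i, j); rewrite !ffunE.
  by apply: asbool_eq_equiv; have := Pvw (i, SeqSub sS); rewrite !ffunE.
congr pair; apply/ffunP => -[i j]; rewrite !ffunE; apply: asbool_equiv_eq => /=.
  exact: eqvw.
by apply: Pvw; case: j.
Qed.

Definition literal n (b : bool) (phi : formula L n) := if b then phi else FNot phi.

Lemma sat_literal M n b (phi : formula L n) (v : 'I_n -> M) :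
  sat M (literal b phi) v <-> `[< sat M phi v >] = b.
Proof.
case: b => /=; first by split=> /asboolP.
by split=> [/asboolPn/negbTE|/negbT/asboolPn].
Qed.

Definition diagram_formula S n (D : diagram_type S n) : formula L n :=
  FAnd (\big[FAnd/FTop]_p literal (D.1 p) (FEq (TVar p.1) (TVar p.2)))
       (\big[FAnd/FTop]_p literal (D.2 p) (P (ssval p.2) (TVar p.1))).

Lemma qfree_diagram_formula S n (D : diagram_type S n) : qfree (diagram_formula D).
Proof. by split; apply: qfree_bigFAnd => p; rewrite /literal; case: ifP. Qed.

Lemma sat_diagram_formula S n (D : diagram_type S n) M (v : 'I_n -> M) :
  sat M (diagram_formula D) v <-> diagram S v = D.
Proof.
case: D => D1 D2; rewrite /diagram_formula /= !sat_bigFAnd_fin /=; split.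
  move=> [H1 H2]; congr pair; apply/ffunP => p; rewrite ffunE.
    by have /sat_literal := H1 p isT.
  by have /sat_literal := H2 p isT.
move=> [<- <-]; split=> p _; apply/sat_literal; by rewrite ffunE.
Qed.

(** * Models, completeness and quantifier elimination *)

Lemma sat_sigma M (I J : {fset W}) n :
  true_in M (sigma I J n) <->
  exists2 v : 'I_n -> M, injective v &
    forall i, (forall s, s \in I -> holds s (v i)) /\
              (forall s, s \in J -> ~ holds s (v i)).
Proof.
have E (v0 : 'I_0 -> M) : sat M (sigma I J n) v0 <->
    exists2 v : 'I_n -> M, injective v &
    forall i, (forall s, s \in I -> holds s (v i)) /\
              (forall s, s \in J -> ~ holds s (v i)).
  rewrite sat_exists_closure; split=> [[v /= [Hinj HP]]|[v vinj vP]].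
    exists v => [i j vij|i].
      have ne (k l : 'I_n) : k < l -> v k <> v l.
        move: Hinj => /sat_bigFAnd_fin/(_ k isT)/sat_bigFAnd_fin; exact.
      by apply: val_inj; case: (ltngtP i j) => // /ne; rewrite vij.
    move: HP => /sat_bigFAnd_fin/(_ i isT)[/sat_bigFAnd HI /sat_bigFAnd HJ].
    by split=> s sI; [apply: HI|apply: HJ].
  exists v; split.
    apply/sat_bigFAnd_fin => i _; apply/sat_bigFAnd_fin => j ij /= /vinj eij.
    by move: ij; rewrite eij ltnn.
  apply/sat_bigFAnd_fin => i _; have [vI vJ] := vP i.
  by split; apply/sat_bigFAnd => s sI _; [apply: vI|apply: vJ].
split=> [H|H v0]; last exact/E.
by apply/(E (tuple0 _)).
Qed.

(** The k + 1 distinct elements given by the sentence for k + 1 cannot all lie in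
    a set with k elements. *)
Lemma model_rich M : is_model (T_omega1 W) M -> rich M.
Proof.
move=> modM S E Q /finite_setP[k Ek].
pose I := [fset s in S | `[< Q s >]]%fset.
pose J := [fset s in S | ~~ `[< Q s >]]%fset.
have disIJ : [disjoint I & J]%fset.
  apply/fdisjointP => s; rewrite !inE /= => /andP[-> ->]; by rewrite andbF.
have /sat_sigma[v vinj vP] : true_in M (sigma I J k.+1).
  by apply: modM; exists I, J, k.+1.
have [i Evi] : exists i, ~ E (v i).
  apply: contrapT => /forallNP allE.
  have : `I_k.+1 #<= `I_k.
    rewrite -{1}(card_ord k.+1) -(card_le_eql (card_setT_fin _)).
    rewrite -(card_le_eqr Ek) -[X in X #<= _](_ : v @^-1` E = _); last first.
      by apply/seteqP; split=> // i _; apply: contrapT; apply: allE.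
    by apply: card_ge_preimage => i j _ _ /vinj.
  by rewrite card_le_II ltnn.
exists (v i) => // s sS; have [vI vJ] := vP i; split=> [hs|Qs].
  apply: contrapT => /asboolPn nQs; apply: (vJ s) => //.
  by rewrite !inE /= sS.
by apply: vI; rewrite !inE /= sS; apply/asboolP.
Qed.

Lemma models_sat_similar n (phi : formula L n) M N (v : 'I_n -> M) (w : 'I_n -> N) :
  is_model (T_omega1 W) M -> is_model (T_omega1 W) N ->
  similar (symbols phi) v w -> sat M phi v <-> sat N phi w.
Proof. by move=> /model_rich ? /model_rich ?; apply: sat_similar. Qed.

(** Each pattern with finitely many true predicates is realized by countably
    many elements: the second component only provides copies. *)
Definition finite_support_structure : structure L :=
  @Structure L ({fset W} * nat)%type (inhabits (fset0, 0))
    (fun f => match f with end)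
    (fun r v => (r : W) \in (v ord0).1).

Lemma finite_support_model : is_model (T_omega1 W) finite_support_structure.
Proof.
move=> _ [I [J [n [disIJ ->]]]]; apply/sat_sigma.
exists (fun i => (I, i : nat)) => [i j [] /ord_inj //|i].
split=> s; rewrite /holds //= => sJ sI.
by have /fdisjointP/(_ s sI)/negP := disIJ.
Qed.

Lemma T_complete : complete_theory (T_omega1 W).
Proof.
pose M0 := finite_support_structure; split.
  by exists M0; apply: finite_support_model.
move=> s.
have agree M (v : 'I_0 -> M) (w : 'I_0 -> M0) : is_model (T_omega1 W) M ->
    sat M s v <-> sat M0 s w.
  move=> modM; apply: models_sat_similar => //; first exact: finite_support_model.
  by split=> [[]|? []].
have [s0|ns0] := pselect (true_in M0 s); [left|right] => M modM v.
  exact/(agree _ _ (tuple0 _) modM)/s0.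
by move=> sv; apply: ns0 => w; apply/(agree _ v).
Qed.

(** The equivalent formula is the disjunction of the diagrams of those tuples, in
    any model, that satisfy phi. By [models_sat_similar] one such tuple speaks
    for all tuples with the same diagram. *)
Lemma T_QE : has_QE (T_omega1 W).
Proof.
move=> n phi; pose S := symbols phi.
pose compatible (D : diagram_type S n) := exists M, is_model (T_omega1 W) M /\
  exists2 v : 'I_n -> M, diagram S v = D & sat M phi v.
exists (FNot (\big[FAnd/FTop]_(D | `[< compatible D >]) FNot (diagram_formula D))).
split.
  by apply: qfree_bigFAnd => D; apply: qfree_diagram_formula.
move=> M modM v /=; rewrite sat_bigFAnd_fin; split=> [sv H|].
  apply: (H (diagram S v)); last exact/sat_diagram_formula.
  by apply/asboolP; exists M; split=> //; exists v.
move=> /existsNP[D]; rewrite not_implyE => -[/asboolP[N [modN [w eqD satw]]]].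
move=> /contrapT/sat_diagram_formula; rewrite -eqD => /diagramP sim.
exact/(models_sat_similar modM modN sim).
Qed.

(** * VC-density *)

Lemma elementary_inj M N (h : M -> N) (c d : M) :
  elementary_embedding h -> h c = h d <-> c = d.
Proof.
move=> elh; have := elh 2 (FEq (TVar ord0) (TVar ord_max))
  (fun l => if l == ord0 then c else d).
by move=> /= [cd dc]; split.
Qed.

Lemma elementary_similar S M N (h : M -> N) n (v : 'I_n -> M) :
  elementary_embedding h -> similar S v (h \o v).
Proof.
move=> elh; split=> [i j|s i _]; first exact: (elh n (FEq (TVar i) (TVar j)) v).
exact: (elh n (P s (TVar i)) v).
Qed.

Lemma elementary_model (T : theory L) M N (h : M -> N) :
  elementary_embedding h -> is_model T M -> is_model T N.
Proof.
move=> elh modM s Ts w.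
by rewrite (tuple0_eq w (h \o tuple0 M)) -elh; apply: modM.
Qed.

(** The finite part of a code that says where x meets the parameters.  The same
    parameter may occur at several places (u, j); any one of them will do. *)
Definition location M N (h : M -> N) n m k (g : nat -> 'I_m -> M) (x : 'I_n -> N) :
    {ffun 'I_n -> option ('I_k * 'I_m)} :=
  [ffun i => [pick u : 'I_k * 'I_m | `[< x i = h (g u.1 u.2) >]]].

Lemma location_some M N (h : M -> N) n m k (g : nat -> 'I_m -> M) (x : 'I_n -> N)
    i (u : 'I_k * 'I_m) : location h k g x i = Some u -> x i = h (g u.1 u.2).
Proof. by rewrite ffunE; case: pickP => // w /asboolP xw [<-]. Qed.

Lemma location_none M N (h : M -> N) n m k (g : nat -> 'I_m -> M) (x : 'I_n -> N)
    i : location h k g x i = None -> forall u : 'I_k * 'I_m, x i <> h (g u.1 u.2).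
Proof. by rewrite ffunE; case: pickP => // nx _ u /asboolP; rewrite nx. Qed.

(** The realizations x and x' may live in unrelated elementary extensions of M.
    A coordinate located among the parameters is the image of the same element
    of M on both sides; one located nowhere differs from all parameters. *)
Lemma same_code_similar S M N N' (h : M -> N) (h' : M -> N') n m k
    (g : nat -> 'I_m -> M) (x : 'I_n -> N) (x' : 'I_n -> N') (u : 'I_k) :
  elementary_embedding h -> elementary_embedding h' ->
  location h k g x = location h' k g x' -> diagram S x = diagram S x' ->
  similar S (join x (h \o g u)) (join x' (h' \o g u)).
Proof.
move=> elh elh' eqloc /diagramP simx; apply: similar_join => //.
  have [eqh Ph] := elementary_similar S (g u) elh.
  have [eqh' Ph'] := elementary_similar S (g u) elh'.
  split=> [i j|s i sS]; first by rewrite -eqh -eqh'.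
  by rewrite -Ph // -Ph'.
move=> i j /=; case E: (location h k g x i) => [w|].
  rewrite (location_some E); rewrite eqloc in E; rewrite (location_some E).
  by rewrite !elementary_inj.
split=> e; first by have /(_ (u, j)) := location_none E.
by rewrite eqloc in E; have /(_ (u, j)) := location_none E.
Qed.

(** Types are enumerated by decoding pairs of a location and a diagram.  All
    realizations with a given code, in whatever extension, have the same type,
    so decoding can collect the formulas true at any of them. *)
Lemma T_VC_density_one : VC_density_one (T_omega1 W).
Proof.
move=> n m Delta finD.
have [S SD] : exists S : seq W, forall phi, Delta phi -> {subset symbols phi <= S}.
  have /finite_seqP[S eS] : finite_set (\bigcup_(phi in Delta) [set` symbols phi]).
    by apply: bigcup_finite => // phi _; apply: finite_seq.
  exists S => phi Dphi s sphi; suff : [set` S] s by [].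
  by rewrite -eS; exists phi.
exists (m.+1 ^ n * #|diagram_type S n|) => M modM A k A0 Ak.
have [g gA] : exists g : nat -> 'I_m -> M, A `<=` [set g i | i in `I_k].
  have /card_eqPle[/pfcard_geP[A0'|[g]] _] := Ak.
    by case: A0 => a; rewrite A0'.
  by exists g; apply: surj.
pose codes := ({ffun 'I_n -> option ('I_k * 'I_m)} * diagram_type S n)%type.
pose decode (c : codes) : set (instance M n) :=
  [set q | exists N (h : M -> N) x, [/\ elementary_embedding h,
     location h k g x = c.1, diagram S x = c.2 & realized_type h Delta A x q]].
(* The factor k * m + 1 counts the locations of one coordinate; it is at most
   (m + 1) * k because A is nonempty. *)
have -> : m.+1 ^ n * #|diagram_type S n| * k ^ n =
    (m.+1 * k) ^ n * #|diagram_type S n| by rewrite expnMn mulnAC.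
apply: (@card_le_trans _ _ _ [set: codes]); last first.
  rewrite (card_le_eql (card_setT_fin _)) card_le_II card_prod leq_mul2r.
  apply/orP; right; rewrite card_ffun card_option card_prod !card_ord.
  have k_gt0 : 0 < k by have [a /gA[i ik _]] := A0; apply: leq_ltn_trans ik.
  have km_le : (k * m).+1 <= m.+1 * k by rewrite mulnC mulSn -add1n leq_add2r.
  have [->//|n_gt0] := posnP n.
  by rewrite leq_exp2r.
apply: card_le_trans (card_image_le decode _).
apply: subset_card_le => p /complete_type_realized[N [h [elh [x ->]]]].
exists (location h k g x, diagram S x) => //; apply/seteqP; split=> q /=.
  move=> [N' [h' [x' [elh' eqloc eqD [[phi Dphi [a Aa qa]] sx']]]]].
  split; first by exists phi => //; exists a.
  have [u uk gu] := gA _ Aa.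
  have /= := same_code_similar (Ordinal uk) elh' elh eqloc eqD.
  rewrite gu => sim; have modN := elementary_model elh modM.
  have modN' := elementary_model elh' modM.
  have := sat_similar (SD _ Dphi) (model_rich modN') (model_rich modN) sim.
  by case: qa sx' => -> /= sx' <-.
by move=> rq; exists N, h, x.
Qed.

(** * Generic types and failure of VC-minimality *)

Section GenericTypes.
Variable M : structure L.
Hypothesis richM : rich M.

(** The filter generated by the sets of all elements outside E with pattern Q on
    S, for finite E and S.  It is proper because M is rich, and decides every
    supported set. It replaces elements that realize the whole infinite pattern
    Q, which M might not contain. *)
Definition generic (Q : W -> Prop) (B : set M) : Prop :=
  exists S (E : set M), finite_set E /\
    forall c, ~ E c -> (forall s, s \in S -> holds s c <-> Q s) -> B c.

(** Up to a finite set, B is a union of classes of elements with equal patterns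
    on S. *)
Definition supported (S : seq W) (B : set M) : Prop :=
  exists2 E : set M, finite_set E &
    forall c d, ~ E c -> ~ E d -> (forall s, s \in S -> holds s c <-> holds s d) ->
      B c -> B d.

Lemma inst_set_supported m (phi : formula L (1 + m)) (a : 'I_m -> M) :
  supported (symbols phi) (inst_set phi a).
Proof.
exists (range a) => [|c d cNa dNa Pcd]; first exact/finite_image/finite_finset.
apply: (iffLR (sat_similar (S := symbols phi) _ richM richM _)) => //.
apply: similar_join => //; first by split=> // s k; apply: Pcd.
move=> k j; rewrite /tup1; split=> e.
  by case: cNa; exists j.
by case: dNa; exists j.
Qed.

Lemma generic_nonempty Q B : generic Q B -> B !=set0.
Proof.
by move=> [S [E [finE SB]]]; have [c cNE cQ] := richM S Q finE; exists c; apply: SB.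
Qed.

Lemma genericI Q B B' : generic Q B -> generic Q B' -> generic Q (B `&` B').
Proof.
move=> [S [E [finE SB]]] [S' [E' [finE' SB']]].
exists (S ++ S'), (E `|` E'); split=> [|c cNE cQ]; first by rewrite finite_setU.
split; [apply: SB|apply: SB'].
- by move=> Ec; apply: cNE; left.
- by move=> s sS; apply: cQ; rewrite mem_cat sS.
- by move=> Ec; apply: cNE; right.
- by move=> s sS; apply: cQ; rewrite mem_cat sS orbT.
Qed.

(** Richness gives a generic enough element c of pattern Q, which lies in B; the
    support carries membership in B from c to every element outside E whose
    pattern on S is that of Q, hence that of Q'. *)
Lemma supported_generic S B Q Q' : supported S B -> (forall s, s \in S -> Q s <-> Q' s) ->
  generic Q B -> generic Q' B.
Proof.
move=> [E finE SB] QQ' [S1 [E1 [finE1 SB1]]].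
have [|c cNE cQ] := richM (S ++ S1) (E := E `|` E1) Q; first by rewrite finite_setU.
have Bc : B c.
  apply: SB1 => [Ec|s sS]; first by apply: cNE; right.
  by apply: cQ; rewrite mem_cat sS orbT.
exists S, E; split=> // d dNE dQ; apply: SB Bc => // [Ec|s sS].
  by apply: cNE; left.
by rewrite cQ ?mem_cat ?sS // QQ' // dQ.
Qed.

Lemma supportedC S B : supported S B -> supported S (~` B).
Proof.
move=> [E finE SB]; exists E => // c d cNE dNE Pcd nBc Bd; apply: nBc.
by apply: SB Bd => // s /Pcd ?; apply: iff_sym.
Qed.

Lemma supportedU S S' B B' : supported S B -> supported S' B' ->
  supported (S ++ S') (B `|` B').
Proof.
move=> [E finE SB] [E' finE' SB']; exists (E `|` E'); first by rewrite finite_setU.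
move=> c d cNE dNE Pcd [Bc|Bc]; [left; apply: SB Bc|right; apply: SB' Bc].
- by move=> Ec; apply: cNE; left.
- by move=> Ec; apply: dNE; left.
- by move=> s sS; apply: Pcd; rewrite mem_cat sS.
- by move=> Ec; apply: cNE; right.
- by move=> Ec; apply: dNE; right.
- by move=> s sS; apply: Pcd; rewrite mem_cat sS orbT.
Qed.

Lemma genericC S B Q : supported S B -> generic Q (~` B) <-> ~ generic Q B.
Proof.
move=> suppB; split=> [gC gB|ngB].
  by have [c []] := generic_nonempty (genericI gC gB).
have [E finE SB] := supportedC suppB.
exists S, E; split=> // c cNE cQ Bc; apply: ngB; exists S, E; split=> // d dNE dQ.
apply: contrapT => nBd; apply: (SB d c) => // s sS; by rewrite cQ // dQ.
Qed.

Lemma generic_sub Q B B' : B `<=` B' -> generic Q B -> generic Q B'.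
Proof.
move=> BB' [S [E [finE SB]]]; exists S, E; split=> // c cNE cQ; exact/BB'/SB.
Qed.

Lemma genericU S S' B B' Q : supported S B -> supported S' B' ->
  generic Q (B `|` B') <-> generic Q B \/ generic Q B'.
Proof.
move=> suppB suppB'; split=> [gU|[]]; last 2 first.
- by apply: generic_sub => c; left.
- by apply: generic_sub => c; right.
apply: contrapT => /not_orP[/(genericC _ suppB) gB /(genericC _ suppB') gB'].
have [c [[nBc nB'c] [Bc|B'c]]] := generic_nonempty (genericI (genericI gB gB') gU).
  exact: nBc.
exact: nB'c.
Qed.

Lemma boolean_combination_generic (G : set (set M)) Q Q' :
  (forall B, G B -> exists S, supported S B) ->
  (forall B, G B -> generic Q B <-> generic Q' B) ->
  forall X, boolean_combination G X ->
    (exists S, supported S X) /\ (generic Q X <-> generic Q' X).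
Proof.
move=> suppG QQ' X; elim=> {X} [B GB||B _ [[S suppB] eqB]|
    B B' _ [[S suppB] eqB] _ [[S' suppB'] eqB']].
- by split; [apply: suppG|apply: QQ'].
- split; first by exists [::], set0.
  by split=> /generic_nonempty[].
- split; first by exists S; apply: supportedC.
  by rewrite !(genericC _ suppB) eqB.
- split; first by exists (S ++ S'); apply: supportedU.
  by rewrite !(genericU _ suppB suppB') eqB eqB'.
Qed.

(** If the generic types of the patterns with no true predicate and with only P_i
    true agreed on all generators, they would agree on their Boolean
    combinations, among them the set defined by P_i. *)
Lemma generator_splits (Phi : forall m, set (formula L (1 + m))) :
  generating_family M Phi -> forall i : W,
  exists m (phi : formula L (1 + m)) (a : 'I_m -> M),
    Phi m phi /\
    ~ (generic (fun=> False) (inst_set phi a) <->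
       generic (fun s => s = i) (inst_set phi a)).
Proof.
move=> [_ genPhi] i; apply: contrapT => nsplit.
have defP : definable (holds i : set M).
  exists 0, (P i (TVar (lshift 0 ord0))), (tuple0 M).
  by apply: funext => c; rewrite /inst_set /= join_lshift.
have := boolean_combination_generic (Q := fun=> False) (Q' := fun s => s = i) _ _
  (genPhi _ defP).
case=> [||_ eqP].
- by move=> _ [m [phi [a [_ ->]]]]; exists (symbols phi); apply: inst_set_supported.
- move=> _ [m [phi [a [Pphi ->]]]]; apply: contrapT => split_phi.
  by apply: nsplit; exists m, phi, a.
have gP : generic (fun=> False) (holds i : set M).
  by apply/eqP; exists [:: i], set0; split=> // c _ cQ; apply/cQ; rewrite ?mem_head.
have gnP : generic (fun=> False) (~` (holds i : set M)).
  by exists [:: i], set0; split=> // c _ cQ /cQ; rewrite mem_head => /(_ isT).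
by have [c []] := generic_nonempty (genericI gP gnP).
Qed.

(** Take a countably infinite D.  The finite sets S i for i in D cover only
    countably many j, so some j avoids them all; then S j is finite and misses
    some i in D.  This is the step that needs uncountability: over the natural
    numbers it fails for S i := iota 0 i.+1. *)
Lemma free_pair (S : W -> seq W) : ~ countable [set: W] ->
  exists i j, i \notin S j /\ j \notin S i.
Proof.
move=> uncW.
have /infiniteP/card_subP[D Dnat _] : infinite_set [set: W].
  by move=> /finite_set_countable.
have countD : countable D by rewrite (eq_countable Dnat).
have [j jNS] : exists j, forall i, D i -> j \notin S i.
  apply: contrapT => noj; apply: uncW.
  apply: (@sub_countable _ _ _ (\bigcup_(i in D) [set` S i])).
    apply: subset_card_le => j _; apply: contrapT => jNS; apply: noj.
    by exists j => i Di; apply/negP => jS; apply: jNS; exists i.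
  by apply: bigcup_countable => // i _; apply/finite_set_countable/finite_seq.
have [i Di iNS] : exists2 i, D i & i \notin S j.
  apply: contrapT => noi; apply: infinite_nat; rewrite -(eq_finite_set Dnat).
  apply: sub_finite_set (finite_seq (S j)) => i Di /=.
  by apply: contrapT => /negP iNS; apply: noi; exists i.
by exists i, j; split=> //; apply: jNS.
Qed.

Definition two_point (i : W) (u : bool) (j : W) (v : bool) (s : W) : Prop :=
  s = i /\ u \/ s = j /\ v.

Lemma two_pointC i u j v : two_point i u j v = two_point j v i u.
Proof. by apply: funext => s; apply/propext/or_comm. Qed.

(** As j is not in S, the value v of P_j has no influence on B, so the side of B
    on which the pattern falls is controlled by u alone. *)
Lemma splitting_generic S B i j : supported S B -> j \notin S ->
  ~ (generic (fun=> False) B <-> generic (fun s => s = i) B) ->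
  exists u, forall v, generic (two_point i u j v) B /\
                      generic (two_point i (~~ u) j v) (~` B).
Proof.
move=> suppB jNS splitB.
have NE u v : generic (two_point i u j v) B <->
    generic (if u then (fun s => s = i) else fun=> False) B.
  have agree s : s \in S -> two_point i u j v s <->
      (if u then (fun s => s = i) else fun=> False) s.
    move=> sS; have sj : s <> j by move=> sj; rewrite -sj sS in jNS.
    by case: u; split=> [[[]|[]]|] //; left.
  by split; apply: supported_generic suppB _ => s /agree // ?; apply: iff_sym.
have [gB|ngB] := pselect (generic (fun=> False) B).
  have ngB' : ~ generic (fun s => s = i) B by move=> gB'; apply: splitB.
  by exists false => v; split; last (apply/(genericC _ suppB)); rewrite NE.
have gB' : generic (fun s => s = i) B.
  by apply: contrapT => ngB'; apply: splitB; split.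
by exists true => v; split; last (apply/(genericC _ suppB)); rewrite NE.
Qed.

Lemma uncountable_not_generated (Phi : forall m, set (formula L (1 + m))) :
  ~ countable [set: W] -> ~ generating_family M Phi.
Proof.
move=> uncW genPhi; have [nested _] := genPhi.
have splits := generator_splits genPhi.
have /choice[S splitsS] (i : W) : exists S,
    exists m (phi : formula L (1 + m)) (a : 'I_m -> M),
    [/\ Phi m phi, supported S (inst_set phi a) &
     ~ (generic (fun=> False) (inst_set phi a) <->
        generic (fun s => s = i) (inst_set phi a))].
  have [m [phi [a [Pphi sphi]]]] := splits i.
  exists (symbols phi), m, phi, a; split=> //; exact: inst_set_supported.
have [i [j [iNS jNS]]] := free_pair S uncW.
have [m [phi [a [Pphi suppi spliti]]]] := splitsS i.
have [k [psi [b [Ppsi suppj splitj]]]] := splitsS j.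
set A := inst_set phi a in suppi spliti *.
set B := inst_set psi b in suppj splitj *.
have [u Au] := splitting_generic suppi jNS spliti.
have [v Bv'] := splitting_generic suppj iNS splitj.
have Bv u' : generic (two_point i u' j v) B /\ generic (two_point i u' j (~~ v)) (~` B).
  by rewrite !(two_pointC i).
have [c1 [A1 B1]] := generic_nonempty (genericI (Au v).1 (Bv u).1).
have [c2 [A2 B2]] := generic_nonempty (genericI (Au (~~ v)).1 (Bv u).2).
have [c3 [A3 B3]] := generic_nonempty (genericI (Au v).2 (Bv (~~ u)).1).
have [c4 [A4 B4]] := generic_nonempty (genericI (Au (~~ v)).2 (Bv (~~ u)).2).
have [AB|BA|AB|BA] := nested _ _ _ _ Pphi Ppsi a b.
- exact/B2/AB.
- exact/A3/BA.
- exact/B4/AB.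
- exact: (BA _ B1).
Qed.

End GenericTypes.
End UnaryPredicates.

Theorem proposition3p7 (d : Order.disp_t) (W : orderType d) (hW : is_omega1 W) :
  complete_theory (T_omega1 W) /\
  has_QE (T_omega1 W) /\
  dp_minimal (T_omega1 W) /\
  VC_density_one (T_omega1 W) /\
  ~ VC_minimal (T_omega1 W).
Proof.
have [_ uncW _] := hW.
have vcT := @T_VC_density_one W.
split; first exact: T_complete.
split; first exact: T_QE.
split; first exact: VC_density_one_dp_minimal.
split=> // -[M [[/model_rich richM _] [Phi]]].
exact: uncountable_not_generated.
Qed.
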